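(* Let $n\geq 2$ and $\Lambda\geq\lambda>0$. Let $\alpha>0$ be the scaling exponent of the (unique up to normalization) positive singular homogeneous solution $$\Phi_\alpha(x)=|x|^{-\alpha}\,\phi_\alpha\!\left(\arcsin\left(\frac{x_n}{|x|}\right)\right)$$ of $$\Phi_\alpha>0,\quad \mathcal{M}^-_{\lambda,\Lambda}(D^2\Phi_\alpha)=0\ \text{ in }\mathbb{R}^n_+,\qquad \Phi_\alpha=0\ \text{ on }\partial\mathbb{R}^n_+\setminus\{0\}.$$ Then $$\alpha\leq\frac{\Lambda}{\lambda}\,n-1 .$$
   Context: $\mathbb{R}^n_+=\{x=(x',x_n)\in\mathbb{R}^{n-1}\times\mathbb{R} : x_n>0\}$. For a real symmetric $n\times n$ matrix $M$ with eigenvalues $\mu_1,\dots,\mu_n$, the Pucci inf-operator is $\mathcal{M}^-_{\lambda,\Lambda}(M)=\lambda\sum_{\mu_i>0}\mu_i+\Lambda\sum_{\mu_i<0}\mu_i$. It is a known fact (due to Miller, extended by Armstrong, Sirakov and Smart) that there exist a unique exponent $\alpha>0$ and a unique, up to multiplication by a positive constant, $C^2$ function $\phi_\alpha:[0,\frac{\pi}{2}]\to[0,+\infty)$ with $\phi_\alpha(0)=0$ and $\phi_\alpha(\theta)>0$ for $0<\theta\leq\frac{\pi}{2}$, such that the function $\Phi_\alpha$ in the claim is continuous in $\overline{\mathbb{R}^n_+}\setminus\{0\}$ and solves the stated problem. ''Singular homogeneous'' means positively homogeneous with negative homogeneity exponent. *)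

(* Defs.v *)
From HB Require Import structures.
From mathcomp Require Import all_boot all_order all_algebra.
From mathcomp Require Import polyrcf.
From mathcomp Require Import all_classical all_reals all_analysis.

Set Implicit Arguments.
Unset Strict Implicit.
Unset Printing Implicit Defensive.

Import Order.TTheory GRing.Theory Num.Theory.
Import numFieldNormedType.Exports.

Local Open Scope classical_set_scope.
Local Open Scope ring_scope.

Section Pucci.
Variables (R : realType) (n : nat).
Implicit Type M : 'M[R]_n.

(* Real eigenvalues repeated according to multiplicity as roots of the
   characteristic polynomial; for a real symmetric M these are all n of them
   (see perm_eigenvalues). *)
Definition eigenvalues M : seq R :=
  flatten [seq nseq (mup mu (char_poly M)) mu | mu <- rootsR (char_poly M)].

Definition pucci_inf (lambda Lambda : R) M : R :=
  lambda * (\sum_(mu <- eigenvalues M | 0 < mu) mu) +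
  Lambda * (\sum_(mu <- eigenvalues M | mu < 0) mu).

Lemma perm_eigenvalues M (s : seq R) :
  char_poly M = \prod_(mu <- s) ('X - mu%:P) -> perm_eq (eigenvalues M) s.
Proof.
move=> Ms; have p0 : char_poly M != 0 by exact/monic_neq0/char_poly_monic.
apply/allP => x _ /=; apply/eqP.
rewrite count_flatten -map_comp /= sumnE big_map.
rewrite (eq_bigr (fun y => (y == x) * mup y (char_poly M))%N); last first.
  by move=> y _; rewrite /= count_nseq.
have -> : count_mem x s = mup x (char_poly M).
  by rewrite Ms mu_prod_XsubC.
have [rx|nrx] := boolP (x \in rootsR (char_poly M)).
  rewrite (bigD1_seq x) ?uniq_roots//= eqxx mul1n big1 ?addn0// => y /negbTE yx.
  by rewrite yx.
rewrite big1_seq => [|y /andP[_ yr]]; last first.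
  by case: eqP => // yx; rewrite -yx yr in nrx.
rewrite mupNroot//; apply: contra nrx => rx.
by have := roots_on_rootsR p0 => /(_ x); rewrite rx andbT => <-; rewrite in_itv.
Qed.

Lemma pucci_infE lambda Lambda M (s : seq R) :
  char_poly M = \prod_(mu <- s) ('X - mu%:P) ->
  pucci_inf lambda Lambda M =
  lambda * (\sum_(mu <- s | 0 < mu) mu) + Lambda * (\sum_(mu <- s | mu < 0) mu).
Proof.
by move=> /perm_eigenvalues Ms; rewrite /pucci_inf !(perm_big _ Ms).
Qed.

End Pucci.

Section Calculus.
Variable R : realType.

(* g is the derivative of f relative to A: one-sided at the endpoints when A is
   an interval. *)
Definition is_derive_within (A : set R) (f g : R -> R) :=
  forall x, A x -> (f y - f x) / (y - x) @[y --> within A x^'] --> g x.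

Definition C2_within (A : set R) (f : R -> R) :=
  exists f1 f2 : R -> R,
    [/\ is_derive_within A f f1, is_derive_within A f1 f2 &
        {within A, continuous f2}].

Variable n : nat.
Implicit Types (F : 'rV[R]_n -> R) (x : 'rV[R]_n).

Definition partial (i : 'I_n) F : 'rV[R]_n -> R :=
  fun x => 'D_(delta_mx 0 i) F x.

Definition twice_differentiable F x :=
  (\forall y \near x, differentiable F y) /\
  (forall i, differentiable (partial i F) x).

Definition hessian F x : 'M[R]_n := \matrix_(i, j) partial i (partial j F) x.

(* The library norm on 'rV[R]_n is the sup norm. *)
Definition enorm x : R := Num.sqrt (\sum_i x 0 i ^+ 2).

End Calculus.

Section HalfSpace.
Variables (R : realType) (n : nat).

(* The ambient space is R^(n+1); the last coordinate plays the role of x_n. *)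
Definition last_coord (x : 'rV[R]_n.+1) : R := x 0 ord_max.

Definition half_space : set 'rV[R]_n.+1 := [set x | 0 < last_coord x].

Definition closed_half_space : set 'rV[R]_n.+1 := [set x | 0 <= last_coord x].

Definition half_space_boundary : set 'rV[R]_n.+1 := [set x | last_coord x = 0].

Definition homogeneous_profile (alpha : R) (phi : R -> R) (x : 'rV[R]_n.+1) : R :=
  enorm x `^ (- alpha) * phi (asin (last_coord x / enorm x)).

Record singular_solution (lambda Lambda alpha : R) (phi : R -> R) : Prop := {
  profile_C2 : C2_within `[0, pi / 2] phi;
  profile0 : phi 0 = 0;
  profile_gt0 : forall theta, 0 < theta <= pi / 2 -> 0 < phi theta;
  solution_continuous :
    {within closed_half_space `\ 0, continuous (homogeneous_profile alpha phi)};
  solution_gt0 : forall x, half_space x -> 0 < homogeneous_profile alpha phi x;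
  solution_twice_differentiable : forall x, half_space x ->
    twice_differentiable (homogeneous_profile alpha phi) x;
  solution_pucci : forall x, half_space x ->
    pucci_inf lambda Lambda (hessian (homogeneous_profile alpha phi) x) = 0;
  solution_boundary : forall x, half_space_boundary x -> x != 0 ->
    homogeneous_profile alpha phi x = 0 }.

End HalfSpace.

Arguments singular_solution {R} n lambda Lambda alpha phi.

(* Main.v *)
(** Write N for the dimension, K = Lambda/lambda >= 1 and beta = K N - 1, and
    suppose alpha > beta.  The function psi = x_N^K |x|^-(beta + K) is an
    explicit subsolution, so its power v = psi^p with p = alpha/beta > 1 is a
    strict one, with the homogeneity -alpha of Phi; moreover
    M^-(D^2 v) >= eta v / x_N^2 for some eta > 0.  Thanks to the blow-up of this
    bound at the boundary, w = v - eps |x|^-alpha is still a strict subsolution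
    where it is positive, for eps small.  As w < 0 near the boundary, w/Phi
    attains a positive maximum m without any Hopf lemma for Phi, and at a contact
    point D^2 w <= m D^2 Phi contradicts M^-(D^2 Phi) = 0.

    Strictness is never expressed through the eigenvalues of D^2 w.  The spectral
    theorem turns pucci_inf (D^2 Phi) into a sum over k of
    a_k <D^2 Phi y_k, y_k>, with a_k in [lambda, Lambda] and y_k a Parseval frame;
    the second derivatives of w at the contact point in the directions y_k are
    compared with those of m Phi and summed with the same weights. *)

Require Import Defs.
From mathcomp Require Import all_boot all_order all_algebra.
From mathcomp Require Import all_classical all_reals all_analysis.
From mathcomp Require Import spectral sesquilinear complex ring lra.

Import Order.TTheory GRing.Theory Num.Theory.
Import numFieldNormedType.Exports.
Local Open Scope classical_set_scope.
Local Open Scope ring_scope.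

(** * The Pucci operator as a weighted trace *)

Lemma char_poly_similar (K : fieldType) n (P A : 'M[K]_n) :
  P \in unitmx -> char_poly (invmx P *m A *m P) = char_poly A.
Proof.
move=> Pu; rewrite /char_poly.
have PP : map_mx polyC (invmx P) *m map_mx (@polyC K) P = 1%:M.
  by rewrite -map_mxM mulVmx // map_mx1.
have -> : char_poly_mx (invmx P *m A *m P) =
    map_mx polyC (invmx P) *m char_poly_mx A *m map_mx polyC P.
  rewrite /char_poly_mx mulmxBr mulmxBl -!map_mxM; congr (_ - _).
  by rewrite scalar_mxC -mulmxA PP mulmx1.
by rewrite !det_mulmx mulrAC -det_mulmx PP det1 mul1r.
Qed.

Section PucciRealization.
Import ComplexField.

(* The frame consists of the real and imaginary parts of a complex unitary
   eigenbasis, the spectral theorem being available over R[i] only. *)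
Lemma pucci_inf_realization (R : realType) n (lambda Lambda : R) (M : 'M[R]_n) :
  lambda <= Lambda -> M^T = M ->
  exists (I : finType) (a : I -> R) (y : I -> 'rV[R]_n),
    [/\ forall k, lambda <= a k <= Lambda,
        forall i j, \sum_k y k 0 i * y k 0 j = (i == j)%:R
      & \sum_k a k * (\sum_i \sum_j y k 0 i * y k 0 j * M i j)
        = pucci_inf lambda Lambda M].
Proof.
move=> lL Msym; set f := real_complex R.
pose A := map_mx f M.
have Aherm : A \is hermsymmx.
  apply: realsym_hermsym; last by apply/mxOverP => i j; rewrite mxE complex_real.
  by apply/is_hermitianmxP; rewrite expr0 scale1r map_mx_id // map_trmx Msym.
pose U := spectralmx A; pose d := spectral_diag A.
have Uu : U \is unitarymx := spectral_unitarymx A.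
have dR k : d 0 k = f (complex.Re (d 0 k)).
  by have /mxOverP/(_ 0 k)/RRe_real := hermitian_spectral_diag_real Aherm.
have AE : A = invmx U *m diag_mx d *m U.
  exact/orthomx_spectralP/hermitian_normalmx.
have charM : char_poly M = \prod_(mu <- [seq complex.Re (d 0 k) | k : 'I_n])
    ('X - mu%:P).
  apply: (map_poly_inj f).
  rewrite map_char_poly -/A rmorph_prod big_image /= AE.
  rewrite char_poly_similar ?unitarymx_unit// char_poly_trig ?diag_mx_is_trig//.
  apply: eq_bigr => k _; rewrite rmorphB /= map_polyX map_polyC /=.
  by rewrite mxE eqxx mulr1n {1}dR.
have UU : (U ^t*)%sesqui *m U = 1%:M.
  by rewrite -invmx_unitary // mulVmx // unitarymx_unit.
have UAU : U *m A *m (U ^t*)%sesqui = diag_mx d.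
  rewrite AE !mulmxA mulmxV ?unitarymx_unit// mul1mx -mulmxA.
  by rewrite -invmx_unitary // mulmxV ?unitarymx_unit// mulmx1.
(* The boolean selects the real or the imaginary part of an eigenvector. Both parts carry the weight
   fixed by the sign of the eigenvalue; at eigenvalue 0 the weight is immaterial. *)
pose a (k : 'I_n * bool) := if 0 < complex.Re (d 0 k.1) then lambda else Lambda.
pose y (k : 'I_n * bool) : 'rV[R]_n :=
  \row_i (if k.2 then complex.Re (U k.1 i) else complex.Im (U k.1 i)).
have ReD : {morph (@complex.Re R) : u v / u + v} by case=> ? ? [? ?].
have Re_sum (J : finType) (F : J -> R[i]) :
    complex.Re (\sum_j F j) = \sum_j complex.Re (F j).
  exact: (big_morph _ ReD).
have Re_mul (u v : R[i]) : complex.Re (u * Num.conj v) =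
    complex.Re u * complex.Re v + complex.Im u * complex.Im v.
  by case: u v => [? ?] [? ?] /=; rewrite mulrN opprK.
have Re_mulr (u : R[i]) (x : R) : complex.Re (u * f x) = complex.Re u * x.
  by case: u => ? ? /=; rewrite mulr0 subr0.
exists ('I_n * bool)%type, a, y; split => [k|i j|].
- by rewrite /a; case: ifP; rewrite !lexx lL.
- rewrite -(pair_bigA _ (fun k b => y (k, b) 0 i * y (k, b) 0 j)) /=.
  (* The real part of entry [(j, i)] of [U^* U = 1] is the Parseval identity. *)
  have /matrixP/(_ j i)/(congr1 (@complex.Re R)) := UU.
  rewrite !mxE Re_sum eq_sym.
  have -> : complex.Re ((i == j)%:R : R[i]) = (i == j)%:R by case: (i == j).
  move=> <-; apply: eq_bigr => k _.
  by rewrite big_bool /y !mxE (mulrC (Num.conj _)) Re_mul.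
- rewrite (pucci_infE _ _ charM) !big_image_cond /= !mulr_sumr.
  rewrite -(pair_bigA _ (fun k b => a (k, b) *
    (\sum_i \sum_j y (k, b) 0 i * y (k, b) 0 j * M i j))) /=.
  rewrite [X in _ = X + _]big_mkcond [X in _ = _ + X]big_mkcond -big_split /=.
  apply: eq_bigr => k _; rewrite big_bool /a /= -mulrDr.
  (* The forms at the real and imaginary parts of row [k] add up to the real part of entry [(k, k)]
     of [U A U^*], which is the eigenvalue. *)
  set e := (X in _ * X).
  have -> : e = complex.Re (d 0 k).
    have /matrixP/(_ k k)/(congr1 (@complex.Re R)) := UAU.
    rewrite !mxE eqxx mulr1n => <-.
    rewrite Re_sum /e exchange_big [X in _ + X]exchange_big.
    rewrite -big_split /=.
    apply: eq_bigr => j _; rewrite -big_split [in RHS]mxE mulr_suml Re_sum.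
    apply: eq_bigr => i _.
    by rewrite !mxE (mulrAC (U k i)) Re_mulr Re_mul mulrDl.
  by case: ltgtP => [_|_|<-]; rewrite ?mulr0 ?addr0 ?add0r.
Qed.
End PucciRealization.

(** * Second-order differentiation *)

Section SecondOrder.
Context {R : realType}.

(** Otherwise [G1], which vanishes at 0 because of the maximum, is positive just to the right of 0,
    and the mean value theorem yields [G t > G 0] there. *)
Lemma second_derivative_local_max_le0 (G G1 : R -> R) (L : R) :
  (\forall t \near (0 : R), is_derive (t : R) (1 : R) G (G1 t)) ->
  is_derive (0 : R) (1 : R) G1 L ->
  (\forall t \near (0 : R), G t <= G 0) -> L <= 0.
Proof.
move=> /nbhs_ballP[e1 /= e1_gt0 dG] dG1 /nbhs_ballP[e2 /= e2_gt0 maxG].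
rewrite leNgt; apply/negP => L_gt0.
have dG' (t : R) : `|t| < e1 -> is_derive (t : R) (1 : R) G (G1 t).
  by move=> te; apply: dG; rewrite /ball /= sub0r normrN.
have maxG' (t : R) : `|t| < e2 -> G t <= G 0.
  by move=> te; apply: maxG; rewrite /ball /= sub0r normrN.
have G10 : G1 0 = 0.
  pose e := Num.min e1 e2 / 2.
  have e_gt0 : 0 < e by rewrite divr_gt0 // lt_min e1_gt0.
  have ee1 : e < e1.
    by rewrite ltr_pdivrMr // mulr_natr mulr2n ltr_pwDr // ge_min lexx.
  have ee2 : e < e2.
    by rewrite ltr_pdivrMr // mulr_natr mulr2n ltr_pwDr // ge_min lexx orbT.
  have eN0 : - e < e by rewrite gtrN.
  have : is_derive (0 : R) (1 : R) G 0.
    apply: (derive1_at_max (ltW eN0)).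
    - move=> t; rewrite in_itv /= => /andP[t1 t2].
      apply: (@ex_derive _ _ _ _ _ _ (G1 t)); apply: dG'.
      by rewrite (lt_trans _ ee1) // ltr_norml t1.
    - by rewrite in_itv /= e_gt0 oppr_lt0 e_gt0.
    - move=> t; rewrite in_itv /= => /andP[t1 t2].
      by apply: maxG'; rewrite (lt_trans _ ee2) // ltr_norml t1.
  have := dG' 0; rewrite normr0 => /(_ e1_gt0) h1 h2.
  by rewrite -(@derive_val _ _ _ _ _ _ _ h1) (@derive_val _ _ _ _ _ _ _ h2).
have : (fun h => h^-1 *: (G1 (h *: (1 : R) + 0) - G1 0)) @ 0^' --> L.
  rewrite -[X in _ --> X](@derive_val _ _ _ _ _ _ _ dG1).
  exact: (@ex_derive _ _ _ _ _ _ _ dG1).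
(* A quotient at distance less than [L] from its limit [L] is positive. *)
move=> /cvgrPdist_lt/(_ _ L_gt0); rewrite near_withinE.
move=> /nbhs_ballP[e3 /= e3_gt0 G1pos].
pose t := Num.min (Num.min e1 e2) e3 / 2.
have mn_gt0 : 0 < Num.min (Num.min e1 e2) e3 by rewrite !lt_min e1_gt0 e2_gt0.
have t_gt0 : 0 < t by rewrite divr_gt0.
have : t < Num.min (Num.min e1 e2) e3.
  by rewrite ltr_pdivrMr // mulr_natr mulr2n ltr_pwDr.
rewrite !lt_min => /andP[/andP[te1 te2] te3].
have [||c] := @MVT _ G G1 0 t t_gt0.
- move=> x; rewrite in_itv /= => /andP[x0 xt]; apply: dG'.
  by rewrite gtr0_norm // (lt_trans xt).
- apply: derivable_within_continuous => x; rewrite in_itv /= => /andP[x0 xt].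
  apply: (@ex_derive _ _ _ _ _ _ (G1 x)); apply: dG'.
  by rewrite ger0_norm // (le_lt_trans xt).
rewrite in_itv /= => /andP[c0 ct]; rewrite subr0 => GE.
have := G1pos c; rewrite /ball /= sub0r normrN gtr0_norm // gt_eqF //.
move=> /(_ (lt_trans ct te3) isT).
rewrite G10 subr0 addr0 [c *: _]mulr1 /GRing.scale /= ltr_norml => /andP[_].
rewrite gtrBl pmulr_rgt0 ?invr_gt0 // => G1c.
have : 0 < G t - G 0 by rewrite GE mulr_gt0.
by rewrite subr_gt0 ltNge maxG' // gtr0_norm.
Qed.

Lemma derive_partial n (F : 'rV[R]_n -> R) (x y : 'rV[R]_n) :
  differentiable F x -> 'D_y F x = \sum_i y 0 i * partial i F x.
Proof.
move=> dF; rewrite deriveE // {1}[y]row_sum_delta linear_sum.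
by apply: eq_bigr => i _; rewrite linearZ /partial deriveE.
Qed.

Lemma is_derive_line n (F : 'rV[R]_n -> R) (x y : 'rV[R]_n) (t : R) :
  differentiable F (x + t *: y) ->
  is_derive (t : R) (1 : R) (fun s => F (x + s *: y)) ('D_y F (x + t *: y)).
Proof.
move=> dF.
have E : (fun h : R => h^-1 *: (F (x + (h *: (1 : R) + t) *: y) - F (x + t *: y)))
  = (fun h : R => h^-1 *: ((F \o shift (x + t *: y)) (h *: y) - F (x + t *: y))).
  apply/funext => h /=; congr (_ *: (F _ - _)).
  by rewrite [h *: (1 : R)]mulr1 scalerDl addrCA.
apply: DeriveDef.
- by rewrite /derivable /= E; exact: diff_derivable.
- by rewrite /derive /= E.
Qed.

Lemma is_derive2_line n (F : 'rV[R]_n -> R) (x y : 'rV[R]_n) :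
  twice_differentiable F x ->
  is_derive (0 : R) (1 : R) (fun s => \sum_i y 0 i * partial i F (x + s *: y))
    (\sum_i \sum_j y 0 i * y 0 j * hessian F x i j).
Proof.
move=> [_ dF].
have -> : (fun s => \sum_i y 0 i * partial i F (x + s *: y)) =
    \sum_i (fun s => y 0 i * partial i F (x + s *: y)).
  by apply/funext => s; rewrite fct_sumE.
rewrite exchange_big /=.
apply: is_derive_sum => j.
have -> : \sum_i y 0 i * y 0 j * hessian F x i j =
    y 0 j *: 'D_y (partial j F) (x + 0 *: y).
  rewrite scale0r addr0 derive_partial // [RHS]mulr_sumr; apply: eq_bigr => i _.
  by rewrite mxE; ring.
apply: is_deriveZ; apply: is_derive_line.
by rewrite scale0r addr0.
Qed.

End SecondOrder.

(** * Symmetry of the Hessian *)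

Section Young.
Context {R : realType} {n : nat}.
Implicit Types (F : 'rV[R]_n -> R) (x : 'rV[R]_n).

Lemma differentiable_expansion F x (e : R) : 0 < e -> differentiable F x ->
  exists2 d : R, 0 < d & forall h : 'rV[R]_n, `|h| < d ->
    `|F (x + h) - F x - 'D_h F x| <= e * `|h|.
Proof.
move=> e_gt0 dF.
have /eqaddoP/(_ _ e_gt0)/nbhs_ballP[d /= d_gt0 dE] := diff_locally dF.
exists d => // h hd; rewrite deriveE //.
have := dE h; rewrite -ball_normE /= sub0r normrN => /(_ hd).
rewrite !fctE /=; by rewrite opprD addrA [h + x]addrC.
Qed.

Definition second_difference F x (u v : 'rV[R]_n) : R :=
  F (x + u + v) - F (x + u) - F (x + v) + F x.

Lemma second_differenceC F x u v :
  second_difference F x u v = second_difference F x v u.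
Proof. by rewrite /second_difference (addrAC x v); ring. Qed.

(** The mean value theorem in direction [i], applied to the increment of [F] in direction [j],
    reduces the claim to the first-order expansion of [partial i F] at [x]. *)
Lemma second_difference_hessian F x i j (e : R) : 0 < e ->
  twice_differentiable F x ->
  exists2 d : R, 0 < d & forall t, 0 < t < d ->
    `|second_difference F x (t *: delta_mx 0 i) (t *: delta_mx 0 j)
      - t ^+ 2 * hessian F x j i| <= e * t ^+ 2.
Proof.
move=> e_gt0 [/nbhs_ballP[d0 /= d0_gt0 dF] dpF].
have e4_gt0 : 0 < e / 4 by rewrite divr_gt0.
have [d1 d1_gt0 dE] := differentiable_expansion _ _ _ e4_gt0 (dpF i).
pose ei : 'rV[R]_n := delta_mx 0 i; pose ej : 'rV[R]_n := delta_mx 0 j.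
have nd k : `|delta_mx 0 k : 'rV[R]_n| <= 1.
  rewrite [`|_|]mx_normrE; apply: bigmax_le => // -[a b] _ /=.
  by rewrite mxE; case: (_ && _); rewrite ?normr1 ?normr0.
exists (Num.min d0 d1 / 2) => [|t /andP[t_gt0]].
  by rewrite divr_gt0 // lt_min d0_gt0.
rewrite ltr_pdivlMr // lt_min => /andP[t2d0 t2d1].
(* The boolean tells whether the shift by [t *: ej] is present, so both ends of the increment are
   treated at once. *)
have small (c : R) (b : bool) : 0 <= c <= t ->
    `|c *: ei + (b%:R * t) *: ej| <= 2 * t.
  move=> /andP[c0 ct]; rewrite (le_trans (ler_normD _ _)) //.
  rewrite !(normrZ c, normrZ (_ * t)).
  rewrite (ger0_norm c0) [2 * t]mulr_natl mulr2n lerD //.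
    by rewrite -[leRHS]mulr1 ler_pM // nd.
  rewrite -[leRHS]mulr1 ler_pM ?nd // ger0_norm ?mulr_ge0 ?(ltW t_gt0) //.
  by case: b; rewrite ?mul1r ?mul0r ?lexx ?(ltW t_gt0).
have dFl (c : R) (b : bool) : 0 <= c <= t ->
    is_derive (c : R) (1 : R) (fun s => F ((x + (b%:R * t) *: ej) + s *: ei))
      (partial i F (x + (c *: ei + (b%:R * t) *: ej))).
  move=> ct.
  have -> : x + (c *: ei + (b%:R * t) *: ej) = x + (b%:R * t) *: ej + c *: ei.
    by rewrite (addrC (c *: ei)) addrA.
  apply: is_derive_line; apply: dF.
  rewrite -ball_normE /= -addrA (addrC (_ *: ej)) opprD addNKr normrN.
  by rewrite (le_lt_trans (small _ _ ct)) // mulrC.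
pose phi s := F (x + (true%:R * t) *: ej + s *: ei) -
  F (x + (false%:R * t) *: ej + s *: ei).
pose phi' s := partial i F (x + (s *: ei + (true%:R * t) *: ej)) -
  partial i F (x + (s *: ei + (false%:R * t) *: ej)).
have dphi c : 0 <= c <= t -> is_derive (c : R) (1 : R) phi (phi' c).
  by move=> ct; apply: is_deriveB; apply: dFl.
have [||c] := @MVT _ phi phi' 0 t t_gt0.
- by move=> s; rewrite in_itv /= => /andP[s0 st]; apply: dphi; rewrite !ltW.
- apply: derivable_within_continuous => s; rewrite in_itv /= => st.
  exact: (@ex_derive _ _ _ _ _ _ (phi' s)) (dphi _ st).
rewrite in_itv /= subr0 => /andP[c0 ct] phiE.
have ctw : 0 <= c <= t by rewrite !ltW.
have -> : second_difference F x (t *: ei) (t *: ej) = phi t - phi 0.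
  rewrite /phi /second_difference mul1r mul0r !scale0r !addr0 opprB addrA.
  by rewrite (addrAC x (t *: ei)) (addrAC _ (F x)).
rewrite phiE.
(* In [phi' c] the linear parts leave [t] times the mixed derivative. The two remainders are at most
   [e / 4 * (2 * t)] each, hence [e * t ^+ 2] in all after multiplication by [t]. *)
pose err (b : bool) :=
  partial i F (x + (c *: ei + (b%:R * t) *: ej)) - partial i F x
  - 'D_(c *: ei + (b%:R * t) *: ej) (partial i F) x.
have errE (b : bool) : `|err b| <= e / 4 * (2 * t).
  have hb : `|c *: ei + (b%:R * t) *: ej| < d1.
    by rewrite (le_lt_trans (small _ _ ctw)) // mulrC.
  by rewrite (le_trans (dE _ hb)) // ler_pM2l // small.
have dlin b : 'D_(c *: ei + b *: ej) (partial i F) x =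
    c * 'D_ei (partial i F) x + b * 'D_ej (partial i F) x.
  by rewrite deriveE ?linearD ?linearZ ?deriveE.
have -> : phi' c * t - t ^+ 2 * hessian F x j i = (err true - err false) * t.
  rewrite /err /phi' !dlin mxE [partial j _ x]/partial -/ej mul0r mul1r.
  move: (partial i F (x + (c *: ei + t *: ej))).
  move: (partial i F (x + (c *: ei + 0 *: ej))) (partial i F x).
  move: ('D_ei (partial i F) x) ('D_ej (partial i F) x) => a1 a2 a3 a4 a5.
  ring.
have e2 : `|err true - err false| <= e / 4 * (2 * t) + e / 4 * (2 * t).
  by rewrite (le_trans (ler_normB _ _)) // lerD.
rewrite normrM (gtr0_norm t_gt0) expr2 mulrA ler_pM2r // (le_trans e2) //.
by rewrite le_eqVlt; apply/orP; left; apply/eqP; field.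
Qed.

(** Both mixed derivatives are limits of the same quotient, as [second_difference] is symmetric in
    its two increments. The spectral theorem requires this symmetry. *)
Lemma hessian_sym F x :
  twice_differentiable F x -> (hessian F x)^T = hessian F x.
Proof.
move=> dF; apply/matrixP => i j; rewrite mxE; apply/eqP.
rewrite -subr_eq0 -normr_le0; apply/ler_addgt0Pr => e e_gt0; rewrite add0r.
have e2_gt0 : 0 < e / 2 by rewrite divr_gt0.
have [d1 d1_gt0 /= h1] := second_difference_hessian F x i j _ e2_gt0 dF.
have [d2 d2_gt0 /= h2] := second_difference_hessian F x j i _ e2_gt0 dF.
pose t := Num.min d1 d2 / 2.
have mn_gt0 : 0 < Num.min d1 d2 by rewrite lt_min d1_gt0.
have t_gt0 : 0 < t by rewrite divr_gt0.
have : t < Num.min d1 d2.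
  by rewrite ltr_pdivrMr // mulr_natr mulr2n ltr_pwDr.
rewrite lt_min => /andP[td1 td2].
have := h1 t; rewrite t_gt0 td1 => /(_ isT) {}h1.
have := h2 t; rewrite t_gt0 td2 => /(_ isT) {}h2.
rewrite second_differenceC in h2.
have t2_gt0 : 0 < t ^+ 2 by rewrite exprn_gt0.
rewrite -(ler_pM2l t2_gt0) -[X in X * `|_|]gtr0_norm // -normrM.
move: h1 h2; rewrite !ler_norml => /andP[? ?] /andP[? ?]; apply/andP; split; nra.
Qed.

End Young.

(** * The explicit subsolution *)

Section Barrier.
Context {R : realType}.

(* The first summand is S^2 times the Hessian form of psi (divided by psi, at
   |x| = 1, x_N = S) on the plane of x and e_N, in the orthonormal coordinates
   xi along x and zeta across it.  That Hessian has a single negative eigenvalue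
   in this plane; (C, N S) is a rational substitute for its eigenvector. *)
Lemma plane_form_ge0 (N K C S xi zeta : R) :
  2 <= N -> 1 <= K -> 0 < S -> C ^+ 2 + S ^+ 2 = 1 ->
  0 <= (C ^+ 2 + N ^+ 2 * S ^+ 2) *
       (K * N * (K * N - 1) * S ^+ 2 * xi ^+ 2 - 2 * K ^+ 2 * N * C * S * xi * zeta
        + (K * (K - 1) * C ^+ 2 - (K * N + K - 1) * S ^+ 2) * zeta ^+ 2)
     + ((K * N + 2 * K - 1) * S ^+ 2 + K * C ^+ 2) * (C * xi + N * S * zeta) ^+ 2.
Proof.
move=> N2 K1 S0 CS.
pose c := C ^+ 2; pose s := S ^+ 2.
have c0 : 0 <= c by exact: sqr_ge0.
have s0 : 0 < s by exact: exprn_gt0.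
pose mu := (K * N + 2 * K - 1) * s + K * c.
pose w := c + N ^+ 2 * s.
have K0 : 0 < K by lra.
have N0 : 0 < N by lra.
have KN2 : 2 <= K * N.
  have : 0 <= (K - 1) * N by rewrite mulr_ge0 ?(ltW N0) // subr_ge0.
  by lra.
have Kc0 : 0 <= K * c by rewrite mulr_ge0 // ltW.
have mu0 : 0 < mu.
  have : 0 < (K * N + 2 * K - 1) * s by rewrite mulr_gt0 //; lra.
  by rewrite /mu; lra.
have Ns0 : 0 < N ^+ 2 * s by rewrite mulr_gt0 // exprn_gt0.
have w0 : 0 < w by rewrite /w; lra.
(* Coefficients of the form in [xi] and [zeta], with off-diagonal entry [h * (C * S)]. It remains to
   see that [P11] is positive and the determinant nonnegative. *)
pose P11 := w * (K * N * (K * N - 1) * s) + mu * c.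
pose P22 := w * (K * (K - 1) * c - (K * N + K - 1) * s) + mu * N ^+ 2 * s.
pose h := mu * N - w * K ^+ 2 * N.
set E := (X in 0 <= X).
have EE : E = P11 * xi ^+ 2 + 2 * h * (C * S) * (xi * zeta) + P22 * zeta ^+ 2.
  by rewrite /E /P11 /P22 /h /mu /w /c /s; ring.
have P11_gt0 : 0 < P11.
  have h1 : 0 < w * (K * N * (K * N - 1) * s) by rewrite !mulr_gt0 //; lra.
  have h2 : 0 <= mu * c by rewrite mulr_ge0 // ltW.
  by rewrite /P11; lra.
have det_ge0 : 0 <= P11 * P22 - h ^+ 2 * (c * s).
  (* The determinant is [w] times a binary cubic in [c] and [s] with nonnegative coefficients. *)
  pose r3 := K ^+ 2 * (K - 1).
  pose r2 := K * (K ^+ 2 * N ^+ 2 - K * N + 2 * (K - 1) ^+ 2).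
  pose r1 := 3 * N ^+ 2 * K ^+ 3 - (N ^+ 2 + 2 * N + 2) * K ^+ 2 + (N + 3) * K - 1.
  pose r0 := N ^+ 3 * K ^+ 2 * (K * N - 1).
  have -> : P11 * P22 - h ^+ 2 * (c * s) =
      w * (r3 * c ^+ 3 + r2 * (c ^+ 2 * s) + r1 * (c * s ^+ 2) + r0 * s ^+ 3).
    rewrite /P11 /P22 /h /mu /w /r0 /r1 /r2 /r3; ring.
  have r3_ge0 : 0 <= r3 by rewrite /r3 mulr_ge0 ?exprn_ge0 ?(ltW K0) // subr_ge0.
  have r2_ge0 : 0 <= r2.
    rewrite /r2 mulr_ge0 ?(ltW K0) //.
    have : 0 <= K * N * (K * N - 1) by rewrite mulr_ge0 //; lra.
    have := sqr_ge0 (K - 1); rewrite !expr2; lra.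
  have r1_ge0 : 0 <= r1.
    (* The terms bounded in [h1] and [h2] add up to the part of [r1] of degree at least 2 in [K];
       what is left is [K * N + 3 * K - 1]. *)
    have h1 : 0 <= 3 * N ^+ 2 * K ^+ 2 * (K - 1).
      by rewrite !mulr_ge0 ?exprn_ge0 ?(ltW N0) ?(ltW K0) ?subr_ge0.
    have h2 : 0 <= K ^+ 2 * ((N - 2) * N * 2 + (N - 2) * 2 + 2).
      rewrite mulr_ge0 ?exprn_ge0 ?(ltW K0) // !addr_ge0 ?mulr_ge0 ?subr_ge0 //.
      exact: ltW.
    rewrite /r1; lra.
  have r0_ge0 : 0 <= r0.
    by rewrite /r0 !mulr_ge0 ?exprn_ge0 ?(ltW K0) ?(ltW N0) //; lra.
  have s_ge0 := ltW s0.
  have cs2_ge0 : 0 <= c * s ^+ 2 := mulr_ge0 c0 (exprn_ge0 2 s_ge0).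
  have c2s_ge0 : 0 <= c ^+ 2 * s := mulr_ge0 (exprn_ge0 2 c0) s_ge0.
  have c3_ge0 := exprn_ge0 3 c0; have s3_ge0 := exprn_ge0 3 s_ge0.
  apply: (mulr_ge0 (ltW w0)).
  apply: (addr_ge0 (addr_ge0 (addr_ge0 _ _) _) _); exact: mulr_ge0.
rewrite -(pmulr_rge0 _ P11_gt0) EE.
have -> : P11 * (P11 * xi ^+ 2 + 2 * h * (C * S) * (xi * zeta) + P22 * zeta ^+ 2) =
    (P11 * xi + h * (C * S) * zeta) ^+ 2 + (P11 * P22 - h ^+ 2 * (c * s)) * zeta ^+ 2.
  rewrite /c /s; ring.
by rewrite addr_ge0 ?sqr_ge0 // mulr_ge0 ?sqr_ge0.
Qed.

(* The summand is a_k <D^2 v y_k, y_k> / v at a point with |x| = 1, x_N = S,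
   where xi = <x, y_k>, zeta is the orthogonal coordinate in the plane of x and
   e_N, and e = |y_k|^2. *)
Lemma barrier_form_sum (I : finType) (a xi zeta e : I -> R)
    (lambda K N p C S : R) :
  2 <= N -> 1 <= K -> 1 <= p -> 0 < lambda -> 0 < S -> C ^+ 2 + S ^+ 2 = 1 ->
  (forall k, lambda <= a k <= K * lambda) ->
  (forall k, xi k ^+ 2 + zeta k ^+ 2 <= e k) ->
  \sum_k xi k ^+ 2 = 1 -> \sum_k zeta k ^+ 2 = 1 ->
  \sum_k xi k * zeta k = 0 -> \sum_k e k = N ->
  p * (p - 1) * lambda * K ^+ 2 / S ^+ 2 <=
  \sum_k a k * (let g := p * K in let s := p * (K * (N + 1) - 1) in
    let y := S * xi k + C * zeta k in
    g * (g - 1) * (y / S) ^+ 2 + s * (s + 2) * xi k ^+ 2 - s * e k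
    - 2 * g * s * xi k * (y / S)).
Proof.
move=> N2 K1 p1 l0 S0 CS aB xze X1 Z1 XZ0 eN.
have K0 : 0 < K by lra.
have N0 : 0 < N by lra.
have S2 : 0 < S ^+ 2 by rewrite exprn_gt0.
have SN0 : S != 0 by rewrite gt_eqF.
pose s := K * (N + 1) - 1.
pose mu := (K * N + 2 * K - 1) * S ^+ 2 + K * C ^+ 2.
pose w := C ^+ 2 + N ^+ 2 * S ^+ 2.
have w0 : 0 < w.
  have : 0 < N ^+ 2 * S ^+ 2 by rewrite mulr_gt0 ?exprn_gt0.
  by have := sqr_ge0 C; rewrite /w; lra.
have KN2 : 2 <= K * N.
  have : 0 <= (K - 1) * N by rewrite mulr_ge0 ?(ltW N0) // subr_ge0.
  by lra.
(* [q] is [S ^+ 2] times the form for psi itself, the case [p = 1]; [b] dominates its negative part;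
   [G] is [S ^+ 2] times the squared logarithmic derivative of psi along [y_k]. *)
pose q k := K * (K - 1) * (S * xi k + C * zeta k) ^+ 2
  + s * (s + 2) * S ^+ 2 * xi k ^+ 2 - s * S ^+ 2 * e k
  - 2 * K * s * S * xi k * (S * xi k + C * zeta k).
pose b k := mu / w * (C * xi k + N * S * zeta k) ^+ 2
  + s * S ^+ 2 * (e k - xi k ^+ 2 - zeta k ^+ 2).
pose G k := ((K - s) * S * xi k + K * C * zeta k) ^+ 2.
have sumE (x y z : R) : \sum_k (x * xi k ^+ 2 + y * (xi k * zeta k) + z * zeta k ^+ 2)
    = x + z.
  by rewrite !big_split /= -!mulr_sumr X1 Z1 XZ0 mulr0 addr0 !mulr1.
have bsum : \sum_k b k = mu + s * S ^+ 2 * (N - 2).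
  rewrite (eq_bigr (fun k => (mu / w * C ^+ 2 * xi k ^+ 2
    + mu / w * (2 * C * N * S) * (xi k * zeta k)
    + mu / w * (N ^+ 2 * S ^+ 2) * zeta k ^+ 2)
    + (s * S ^+ 2 * e k + - (s * S ^+ 2 * xi k ^+ 2 + 0 * (xi k * zeta k)
    + s * S ^+ 2 * zeta k ^+ 2)))); last by move=> k _; rewrite /b; ring.
  rewrite big_split sumE big_split sumrN sumE /= -mulr_sumr eN -mulrDr.
  by rewrite -/w mulfVK ?gt_eqF //; ring.
(* Exactly [K - 1] times the sum of [b]: this produces the cancellation in [main]. *)
have qsum : \sum_k q k = (K - 1) * (mu + s * S ^+ 2 * (N - 2)).
  rewrite (eq_bigr (fun k =>
      ((K * (K - 1) * S ^+ 2 + s * (s + 2) * S ^+ 2 - 2 * K * s * S ^+ 2) * xi k ^+ 2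
      + (K * (K - 1) * (2 * S * C) - 2 * K * s * S * C) * (xi k * zeta k)
      + K * (K - 1) * C ^+ 2 * zeta k ^+ 2)
    + - (s * S ^+ 2 * e k))); last by move=> k _; rewrite /q; ring.
  by rewrite big_split sumrN sumE /= -mulr_sumr eN /mu /s; ring.
(* Since [s - K = K * N - 1] is at least [K], the sum is at least [K ^+ 2 * (S ^+ 2 + C ^+ 2)]. *)
have Gsum : K ^+ 2 <= \sum_k G k.
  rewrite (eq_bigr (fun k => ((K - s) ^+ 2 * S ^+ 2 * xi k ^+ 2
      + 2 * (K - s) * S * K * C * (xi k * zeta k)
      + K ^+ 2 * C ^+ 2 * zeta k ^+ 2))); last by move=> k _; rewrite /G; ring.
  rewrite sumE -[X in X <= _]mulr1 -CS mulrDr addrC lerD2r ler_pM2r // /s.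
  rewrite -subr_ge0.
  have -> : (K - (K * (N + 1) - 1)) ^+ 2 - K ^+ 2 =
    (K * N - 1 - K) * (K * N - 1 + K) by ring.
  have : 0 <= K * (N - 2) by rewrite mulr_ge0 ?(ltW K0) // subr_ge0.
  by move=> ?; rewrite mulr_ge0 //; lra.
(* The last term of [b] replaces [e k] by [xi k ^+ 2 + zeta k ^+ 2], which leaves the plane form
   divided by [w]. *)
have qb k : 0 <= q k + b k.
  rewrite -(pmulr_rge0 _ w0).
  have := plane_form_ge0 N K C S (xi k) (zeta k) N2 K1 S0 CS.
  set E := (X in 0 <= X) => E0.
  have -> // : w * (q k + b k) = E.
  rewrite /q /b mulrDr [w * (_ / w * _ + _)]mulrDr !mulrA (mulrC w mu).
  rewrite mulfK ?gt_eqF //.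
  rewrite /E /mu /w /s; ring.
have b0 k : 0 <= b k.
  rewrite addr_ge0 // mulr_ge0 ?sqr_ge0 //.
    rewrite divr_ge0 ?(ltW w0) // /mu addr_ge0 // mulr_ge0 ?sqr_ge0 ?(ltW K0) //.
    by lra.
  by rewrite mulr_ge0 ?(ltW S2) // /s; lra.
  by have := xze k; lra.
(* Split a_k = lambda + (a_k - lambda), using q >= - b for the second part. *)
have main : 0 <= \sum_k a k * q k.
  have : 0 <= \sum_k (a k - lambda) * (q k + b k).
    by apply: sumr_ge0 => k _; rewrite mulr_ge0 // subr_ge0; case/andP: (aB k).
  have : 0 <= \sum_k (K * lambda - a k) * b k.
    by apply: sumr_ge0 => k _; rewrite mulr_ge0 // subr_ge0; case/andP: (aB k).
  move=> h1 h2; have := addr_ge0 h1 h2; rewrite -big_split /=.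
  rewrite (eq_bigr (fun k => a k * q k + (- lambda * q k + (K * lambda - lambda) * b k)));
    last by move=> k _; ring.
  rewrite big_split big_split /= -!mulr_sumr qsum bsum.
  set T := (mu + _).
  have -> : - lambda * ((K - 1) * T) + (K * lambda - lambda) * T = 0.
    by ring.
  by rewrite addr0.
have -> : p * (p - 1) * lambda * K ^+ 2 / S ^+ 2 =
    p / S ^+ 2 * ((p - 1) * lambda * K ^+ 2).
  by ring.
(* Chain rule for the power psi^p: the gradient term [G] enters with the factor [p - 1], the source
   of strictness. *)
rewrite (eq_bigr (fun k => p / S ^+ 2 * (a k * q k + (p - 1) * (a k * G k)))); last first.
  move=> k _ /=; rewrite /q /G -/s; field => //.
rewrite -mulr_sumr ler_pM2l ?divr_gt0 ?(lt_le_trans ltr01 p1) // big_split /=.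
apply: ler_wpDl => //; rewrite -mulr_sumr -mulrA ler_wpM2l ?subr_ge0 //.
apply: (@le_trans _ _ (\sum_k lambda * G k)).
  by rewrite -mulr_sumr ler_pM2l.
by apply: ler_sum => k _; rewrite ler_wpM2r ?sqr_ge0 //; case/andP: (aB k).
Qed.

End Barrier.

(** * Powers of the last coordinate and of the norm along a line *)

Section BarrierAlongLine.
Context {R : realType}.

(* The restriction of x_N^kappa |x|^-sigma to the line through a point with
   |x| = 1, x_N = S, in a direction y with y_N = c, <x, y> = b, |y|^2 = e. *)
Definition power_line (kappa sigma S b c e t : R) : R :=
  expR (kappa * ln (S + c * t) - sigma / 2 * ln (1 + 2 * b * t + e * t ^+ 2)).

Definition power_line_logderiv (kappa sigma S b c e t : R) : R :=
  kappa * (c / (S + c * t)) - sigma * ((b + e * t) / (1 + 2 * b * t + e * t ^+ 2)).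

Lemma is_derive_affine (u v t : R) :
  is_derive (t : R) (1 : R) (fun s : R => u + v * s) v.
Proof.
have h := is_deriveD (is_derive_cst u t 1) (is_deriveZ v (is_derive_id t (1 : R))).
by apply: is_derive_eq h _; rewrite add0r [LHS]mulr1.
Qed.

Lemma is_derive_quadratic (u v w t : R) :
  is_derive (t : R) (1 : R) (fun s : R => u + v * s + w * s ^+ 2) (v + 2 * w * t).
Proof.
have h := is_deriveD (is_derive_affine u v t)
  (is_deriveZ w (is_deriveX 2 (is_derive_id t (1 : R)))).
by apply: is_derive_eq h _; rewrite /GRing.scale /= ; ring.
Qed.

Lemma is_derive_power_line kappa sigma S b c e t :
  0 < S + c * t -> 0 < 1 + 2 * b * t + e * t ^+ 2 ->
  is_derive (t : R) (1 : R) (power_line kappa sigma S b c e)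
    (power_line kappa sigma S b c e t * power_line_logderiv kappa sigma S b c e t).
Proof.
move=> l0 r0.
pose l (s : R) := S + c * s; pose r (s : R) := 1 + 2 * b * s + e * s ^+ 2.
have dl : is_derive (t : R) (1 : R) l c := is_derive_affine S c t.
have dr : is_derive (t : R) (1 : R) r (2 * b + 2 * e * t) :=
  is_derive_quadratic 1 (2 * b) e t.
have dll : is_derive (t : R) (1 : R) (@ln R \o l) ((l t)^-1 * c).
  by apply: is_derive1_comp; exact: is_derive1_ln.
have drr : is_derive (t : R) (1 : R) (@ln R \o r) ((r t)^-1 * (2 * b + 2 * e * t)).
  by apply: is_derive1_comp; exact: is_derive1_ln.
have -> : power_line kappa sigma S b c e =
    @expR R \o (kappa *: (@ln R \o l) - (sigma / 2) *: (@ln R \o r)).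
  by apply/funext.
apply: is_derive_eq.
rewrite /power_line_logderiv /power_line /GRing.scale /= !fctE /= -/(l t) -/(r t).
congr (_ * _); field.
by rewrite !gt_eqF.
Qed.

(** The second derivative is the value times [L ^+ 2 + L'], where [L] is the logarithmic derivative;
    at 0 the norm equals 1 and only the power of [S] remains in the value. *)
Lemma is_derive2_power_line kappa sigma S b c e :
  0 < S ->
  is_derive (0 : R) (1 : R)
    (fun t => power_line kappa sigma S b c e t *
      power_line_logderiv kappa sigma S b c e t)
    (expR (kappa * ln S) * (kappa * (kappa - 1) * (c / S) ^+ 2
      + sigma * (sigma + 2) * b ^+ 2 - sigma * e - 2 * kappa * sigma * b * (c / S))).
Proof.
move=> S0.
pose l (s : R) := S + c * s; pose r (s : R) := 1 + 2 * b * s + e * s ^+ 2.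
have l0 : l 0 = S by rewrite /l mulr0 addr0.
have r0 : r 0 = 1 by rewrite /r expr2 !mulr0 !addr0.
have dl : is_derive (0 : R) (1 : R) l c := is_derive_affine S c 0.
have dr : is_derive (0 : R) (1 : R) r (2 * b + 2 * e * 0) :=
  is_derive_quadratic 1 (2 * b) e 0.
have dp := is_derive_power_line kappa sigma S b c e 0.
have {}dp : is_derive (0 : R) (1 : R) (power_line kappa sigma S b c e)
    (power_line kappa sigma S b c e 0 * power_line_logderiv kappa sigma S b c e 0).
  by apply: dp; rewrite -?/(l 0) -?/(r 0) ?l0 ?r0.
have dlV : is_derive (0 : R) (1 : R) (fun s => (l s)^-1) (- (l 0) ^- 2 *: c).
  by apply: is_deriveV; rewrite l0 gt_eqF.
have drV : is_derive (0 : R) (1 : R) (fun s => (r s)^-1)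
    (- (r 0) ^- 2 *: (2 * b + 2 * e * 0)).
  by apply: is_deriveV; rewrite r0 oner_eq0.
have dn := is_derive_affine b e 0.
have -> : (fun t => power_line kappa sigma S b c e t *
    power_line_logderiv kappa sigma S b c e t)
   = power_line kappa sigma S b c e * ((kappa * c) *: (fun s => (l s)^-1)
      - sigma *: ((fun s : R => b + e * s) * (fun s => (r s)^-1))).
  by apply/funext => t; rewrite /power_line_logderiv !fctE /= /GRing.scale /= mulrA.
apply: is_derive_eq.
rewrite /power_line_logderiv !fctE /GRing.scale /= -/(l 0) -/(r 0) l0 r0.
rewrite /power_line -/(l 0) -/(r 0) l0 r0 ln1 !mulr0 subr0 !addr0.
field.
by rewrite gt_eqF.
Qed.

End BarrierAlongLine.

(** * Comparison at a contact point *)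

Lemma is_derive_near_gt0 {R : realType} (f : R -> R) (t l : R) :
  is_derive (t : R) (1 : R) f l -> 0 < f t -> \forall s \near t, 0 < f s.
Proof.
move=> df ft.
have /derivable1_diffP/differentiable_continuous cf : derivable f t 1.
  exact: (@ex_derive _ _ _ _ _ _ l).
exact: (cvgr_gt _ cf).
Qed.

Section Contact.
Context {R : realType} {n : nat}.
Implicit Types (x y : 'rV[R]_n.+1).

(* Equal to x_N^gamma |x|^-(gamma + alpha) - eps |x|^-alpha in the half-space. *)
Definition barrier (alpha gamma eps : R) x : R :=
  enorm x `^ (- alpha) * ((last_coord x / enorm x) `^ gamma - eps).

Lemma enorm_gt0 x : 0 < last_coord x -> 0 < enorm x.
Proof.
move=> x0; rewrite sqrtr_gt0 (bigD1 ord_max) //= ltr_wpDr ?exprn_gt0 //.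
by apply: sumr_ge0 => i _; exact: sqr_ge0.
Qed.

Lemma ln_enorm x : 0 < last_coord x -> ln (enorm x) = ln (\sum_i x 0 i ^+ 2) / 2.
Proof.
move=> /enorm_gt0 h; have s0 : 0 <= \sum_i x 0 i ^+ 2.
  by apply: sumr_ge0 => i _; exact: sqr_ge0.
by rewrite -[in RHS](sqr_sqrtr s0) lnXn // -[RHS]/(_ *+ 2 / 2) -mulr_natr mulfK.
Qed.

(** The spurious exponent 0 makes both terms instances of [power_line] along lines; the squared norm
    is used because it is quadratic in the parameter. *)
Lemma barrierE alpha gamma eps x : 0 < last_coord x ->
  barrier alpha gamma eps x =
    expR (gamma * ln (last_coord x)
          - (gamma + alpha) / 2 * ln (\sum_i x 0 i ^+ 2))
    - eps * expR (0 * ln (last_coord x) - alpha / 2 * ln (\sum_i x 0 i ^+ 2)).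
Proof.
move=> x0; have r0 := enorm_gt0 _ x0.
rewrite /barrier /powR !gt_eqF ?divr_gt0 // ln_div ?posrE // ln_enorm //.
set a := ln _; set b := ln _.
rewrite mulrBr -expRD (mulrC _ eps); by congr (expR _ - _ * expR _); field.
Qed.

Lemma sumr_sq_line x y t : \sum_i (x + t *: y) 0 i ^+ 2 =
  \sum_i x 0 i ^+ 2 + 2 * (\sum_i x 0 i * y 0 i) * t + (\sum_i y 0 i ^+ 2) * t ^+ 2.
Proof.
rewrite mulr_sumr !mulr_suml -!big_split /=; apply: eq_bigr => i _.
by rewrite !mxE; ring.
Qed.

(** Along the line through [x] in direction [y], the barrier minus [m * F] has a local maximum, with
    value 0, at [x]. *)
Lemma contact_second_order (F : 'rV[R]_n.+1 -> R)
    (alpha gamma eps m b c e : R) x y :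
  twice_differentiable F x -> 0 < last_coord x -> \sum_i x 0 i ^+ 2 = 1 ->
  (forall z, 0 < last_coord z -> barrier alpha gamma eps z <= m * F z) ->
  barrier alpha gamma eps x = m * F x ->
  b = \sum_i x 0 i * y 0 i -> c = last_coord y / last_coord x ->
  e = \sum_i y 0 i ^+ 2 ->
  last_coord x `^ gamma * (gamma * (gamma - 1) * c ^+ 2
    + (gamma + alpha) * (gamma + alpha + 2) * b ^+ 2 - (gamma + alpha) * e
    - 2 * gamma * (gamma + alpha) * b * c)
  - eps * (alpha * (alpha + 2) * b ^+ 2 - alpha * e)
  <= m * \sum_i \sum_j y 0 i * y 0 j * hessian F x i j.
Proof.
move=> dF S0 x1 le_bF eq_bF bE cE eE.
set S := last_coord x in cE S0 *.
pose P1 := power_line gamma (gamma + alpha) S b (last_coord y) e.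
pose P2 := power_line 0 alpha S b (last_coord y) e.
pose L1 := power_line_logderiv gamma (gamma + alpha) S b (last_coord y) e.
pose L2 := power_line_logderiv 0 alpha S b (last_coord y) e.
pose G t := P1 t - eps * P2 t - m * F (x + t *: y).
pose G1 t := P1 t * L1 t - eps * (P2 t * L2 t)
  - m * \sum_i y 0 i * partial i F (x + t *: y).
have lE t : last_coord (x + t *: y) = S + last_coord y * t.
  by rewrite /last_coord !mxE mulrC.
have rE t : \sum_i (x + t *: y) 0 i ^+ 2 = 1 + 2 * b * t + e * t ^+ 2.
  by rewrite sumr_sq_line x1 -bE -eE.
have GE t : 0 < S + last_coord y * t ->
    G t = barrier alpha gamma eps (x + t *: y) - m * F (x + t *: y).
  by move=> l0; rewrite barrierE ?lE // rE.
have nl : \forall t \near (0 : R), 0 < S + last_coord y * t.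
  apply: is_derive_near_gt0 (is_derive_affine _ _ _) _.
  by rewrite mulr0 addr0.
have nr : \forall t \near (0 : R), 0 < 1 + 2 * b * t + e * t ^+ 2.
  apply: is_derive_near_gt0 (is_derive_quadratic _ _ _ _) _.
  by rewrite expr2 !mulr0 !addr0.
have nd : \forall t \near (0 : R), differentiable F (x + t *: y).
  have cl : (fun t : R => x + t *: y) @ (0 : R) --> x.
    rewrite -[X in _ --> X]addr0 -(scale0r y); apply: cvgD; first exact: cvg_cst.
    apply: cvgZr_tmp; exact: cvg_id.
  by case: dF => /cl.
have G0 : G 0 = 0.
  by rewrite GE ?mulr0 ?addr0 // scale0r addr0 eq_bF subrr.
rewrite -subr_le0.
apply: (@second_derivative_local_max_le0 R G G1).
- near=> t.
  apply: is_deriveB; [apply: is_deriveB|].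
  + by apply: is_derive_power_line; near: t.
  + by apply: is_deriveZ; apply: is_derive_power_line; near: t.
  + have dFt : differentiable F (x + t *: y) by near: t.
    by apply: is_deriveZ; rewrite -derive_partial //; exact: is_derive_line.
- apply: is_deriveB; [apply: is_deriveB|].
  + apply: is_derive_eq (is_derive2_power_line _ _ _ _ _ _ S0) _.
    by rewrite /powR gt_eqF // cE.
  + apply: is_deriveZ; apply: is_derive_eq (is_derive2_power_line _ _ _ _ _ _ S0) _.
    by rewrite mul0r expR0; ring.
  + by apply: is_deriveZ; exact: is_derive2_line.
- near=> t.
  have lt0 : 0 < S + last_coord y * t by near: t.
  by rewrite G0 GE // subr_le0 le_bF // lE.
Unshelve. all: by end_near.
Qed.

End Contact.

(** * Reduction to a meridian and existence of a contact point *)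

Section Comparison.
Context {R : realType} {n : nat}.

(** For [s] in [0, 1], a unit vector at height [s]. One per height suffices, as the functions
    compared depend only on the norm and on the ratio of last coordinate to norm. *)
Definition meridian (s : R) : 'rV[R]_n.+1 :=
  Num.sqrt (1 - s ^+ 2) *: delta_mx 0 ord0 + s *: delta_mx 0 ord_max.

Context (n_gt0 : (0 < n)%N).

Lemma meridianE s i : meridian s 0 i =
  if i == ord0 then Num.sqrt (1 - s ^+ 2) else if i == ord_max then s else 0.
Proof.
have h : (ord0 == ord_max :> 'I_n.+1) = false by rewrite -val_eqE /= ltn_eqF.
rewrite !mxE eqxx /=; have [->|_] := eqVneq i ord0.
  by rewrite h mulr1 mulr0 addr0.
by rewrite mulr0 add0r; case: eqP => _; rewrite ?mulr1 ?mulr0.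
Qed.

Lemma sum_meridian (s : R) (g : 'I_n.+1 -> R) :
  \sum_i meridian s 0 i * g i = Num.sqrt (1 - s ^+ 2) * g ord0 + s * g ord_max.
Proof.
have h : (ord_max != ord0 :> 'I_n.+1) by rewrite -val_eqE /= -lt0n.
rewrite (bigD1 ord0) //= (bigD1 ord_max) //= big1 ?addr0.
  by rewrite !meridianE eqxx (negbTE h) eqxx.
by move=> i /andP[i0 i1]; rewrite meridianE (negbTE i0) (negbTE i1) mul0r.
Qed.

Lemma last_coord_meridian s : last_coord (meridian s) = s.
Proof.
by rewrite /last_coord meridianE eqxx -val_eqE /= gtn_eqF.
Qed.

Lemma sum_sq_meridian s : 0 <= s <= 1 -> \sum_i meridian s 0 i ^+ 2 = 1.
Proof.
move=> /andP[s0 s1].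
rewrite (eq_bigr (fun i => meridian s 0 i * meridian s 0 i)) //.
rewrite sum_meridian -/(last_coord _) last_coord_meridian meridianE eqxx -expr2.
rewrite sqr_sqrtr; first by ring.
by rewrite subr_ge0 expr_le1.
Qed.

Lemma enorm_meridian s : 0 <= s <= 1 -> enorm (meridian s) = 1.
Proof. by move=> s01; rewrite /enorm sum_sq_meridian ?sqrtr1. Qed.

Lemma meridian_continuous : continuous meridian.
Proof.
move=> s; apply: cvgD; apply: cvgZr_tmp; last exact: cvg_id.
apply: continuous_comp; last exact: sqrt_continuous.
apply: cvgB; first exact: cvg_cst.
exact: exprn_continuous.
Qed.

Lemma homogeneous_profile_meridian alpha phi (s : R) : 0 <= s <= 1 ->
  homogeneous_profile alpha phi (meridian s) = phi (asin s).
Proof.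
move=> s01; rewrite /homogeneous_profile enorm_meridian // powR1 mul1r.
by rewrite last_coord_meridian divr1.
Qed.

(** The factor |z|^-alpha cancels in the quotient of the two functions, so maximizing it is a
    one-variable problem; [eps < 1] makes the maximum positive. *)
Lemma barrier_contact (lambda Lambda alpha gamma eps : R) (phi : R -> R) :
  singular_solution n lambda Lambda alpha phi -> 0 < gamma -> 0 < eps < 1 ->
  exists s m : R, [/\ 0 < s <= 1, eps < s `^ gamma, 0 < m,
    forall z : 'rV[R]_n.+1, 0 < last_coord z ->
      barrier alpha gamma eps z <= m * homogeneous_profile alpha phi z &
    barrier alpha gamma eps (meridian s) =
      m * homogeneous_profile alpha phi (meridian s)].
Proof.
move=> sol gamma_gt0 /andP[eps_gt0 eps_lt1].
pose F := homogeneous_profile (n := n) alpha phi.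
have F_gt0 s : 0 < s -> 0 < F (meridian s).
  move=> s0; apply: (solution_gt0 sol).
  by rewrite /half_space /= last_coord_meridian.
have F_cont s : 0 < s -> {for s, continuous (F \o meridian)}.
  move=> s0; apply: continuous_comp; first exact: meridian_continuous.
  apply: differentiable_continuous.
  have /(solution_twice_differentiable sol)[/nbhs_singleton //] :
    half_space (meridian s) by rewrite /half_space /= last_coord_meridian.
pose f s := (s `^ gamma - eps) / F (meridian s).
(* The height at which the barrier changes sign. Below it the barrier is negative, so the quotient
   need only be maximized on the compact [[d, 1]], away from the boundary. *)
pose d := eps `^ gamma^-1.
have d_gt0 : 0 < d by exact: powR_gt0.
have d_le1 : d <= 1.
  by rewrite -(powRr0 eps) ger_powR ?invr_ge0 ?(ltW gamma_gt0) // eps_gt0 ltW.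
have dE : d `^ gamma = eps by rewrite -powRrM mulVf ?gt_eqF // powRr1 // ltW.
have f_cont : {within `[d, 1], continuous f}.
  apply: continuous_in_subspaceT => s; rewrite inE /= in_itv /= => /andP[ds s1].
  have s0 : 0 < s := lt_le_trans d_gt0 ds.
  apply: cvgM; last by apply: cvgV; [rewrite gt_eqF // F_gt0|exact: F_cont].
  apply: cvgB; last exact: cvg_cst.
  have /derivable1_diffP/differentiable_continuous : derivable (@powR R ^~ gamma) s 1.
    by apply: ex_derive; exact: is_derive1_powR.
  exact.
have [s] := EVT_max d_le1 f_cont.
rewrite in_itv /= => /andP[ds s1] f_max.
have s_gt0 : 0 < s := lt_le_trans d_gt0 ds.
have f1 : 0 < f 1.
  by rewrite /f powR1 divr_gt0 ?subr_gt0 ?F_gt0.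
have fs_gt0 : 0 < f s.
  by rewrite (lt_le_trans f1) // f_max // in_itv /= d_le1 lexx.
have barrier_meridian t : 0 <= t <= 1 ->
    barrier alpha gamma eps (meridian t) = t `^ gamma - eps.
  move=> t01; rewrite /barrier enorm_meridian // powR1 mul1r divr1.
  by rewrite last_coord_meridian.
exists s, (f s); split => //.
- by rewrite s_gt0.
- by rewrite -subr_gt0; move: fs_gt0; rewrite /f pmulr_lgt0 // invr_gt0 F_gt0.
- move=> z z0; have r0 := enorm_gt0 _ z0.
  pose t := last_coord z / enorm z.
  have t0 : 0 < t by rewrite divr_gt0.
  have t1 : t <= 1.
    rewrite ler_pdivrMr // mul1r.
    rewrite -(gtr0_norm z0) -sqrtr_sqr ler_wsqrtr // (bigD1 ord_max) //=.
    by rewrite lerDl sumr_ge0 // => i _; exact: sqr_ge0.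
  rewrite /barrier /homogeneous_profile -/t.
  rewrite -(homogeneous_profile_meridian alpha) ?(ltW t0) // -/(F _).
  rewrite mulrCA ler_pM2l ?powR_gt0 //.
  have [td|dt] := ltP t d.
    apply: (@le_trans _ _ 0).
      rewrite subr_le0 -dE ge0_ler_powR ?nnegrE ?(ltW gamma_gt0) ?ltW //.
    by rewrite mulr_ge0 ?ltW // F_gt0.
  by rewrite -ler_pdivrMr ?F_gt0 // f_max // in_itv /= dt.
- by rewrite barrier_meridian ?(ltW s_gt0) // /f divfK // gt_eqF // F_gt0.
Qed.

End Comparison.

(** * Contradiction at the contact point *)

Theorem corollary2p8 (R : realType) (n : nat) (lambda Lambda alpha : R)
    (phi : R -> R)
    (n_ge2 : (2 <= n.+1)%N)
    (lambda_gt0 : 0 < lambda) (lambda_le_Lambda : lambda <= Lambda)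
    (alpha_gt0 : 0 < alpha)
    (phi_solution : singular_solution n lambda Lambda alpha phi) :
  alpha <= Lambda / lambda * n.+1%:R - 1.
Proof.
rewrite leNgt; apply/negP => alpha_gt.
have n_gt0 : (0 < n)%N by [].
pose N : R := n.+1%:R; pose K := Lambda / lambda.
have N2 : 2 <= N by rewrite (ler_nat _ 2).
have K1 : 1 <= K by rewrite ler_pdivlMr // mul1r.
have LE : Lambda = K * lambda by rewrite divfK // gt_eqF.
have KN2 : 2 <= K * N.
  have : 0 <= (K - 1) * N by rewrite mulr_ge0 ?subr_ge0 // (le_trans _ N2).
  by lra.
pose beta := K * N - 1.
have beta_gt0 : 0 < beta by rewrite /beta; lra.
pose p := alpha / beta.
have p_gt1 : 1 < p by rewrite ltr_pdivlMr // mul1r.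
pose gamma := p * K.
have gamma_gt0 : 0 < gamma by rewrite mulr_gt0 //; lra.
have alphaE : alpha = p * beta by rewrite divfK // gt_eqF.
(* Bound, proved in [Q2], for the weighted second derivatives of |x|^-alpha at a unit vector. *)
pose M := alpha * (alpha + 2) * Lambda.
have Lambda_gt0 : 0 < Lambda := lt_le_trans lambda_gt0 lambda_le_Lambda.
have M_gt0 : 0 < M by rewrite !mulr_gt0 // addr_gt0.
pose eta := p * (p - 1) * lambda * K ^+ 2.
have K_gt0 : 0 < K by rewrite (lt_le_trans ltr01).
have p_gt0 : 0 < p by rewrite (lt_trans ltr01).
have p1_gt0 : 0 < p - 1 by rewrite subr_gt0.
have eta_gt0 : 0 < eta :=
  mulr_gt0 (mulr_gt0 (mulr_gt0 p_gt0 p1_gt0) lambda_gt0) (exprn_gt0 2 K_gt0).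
pose r := eta / M.
have r_gt0 : 0 < r by rewrite divr_gt0.
(* At a contact point S^gamma r <= eps S^2 while eps < S^gamma; this forces
   r < S, hence r^gamma r < eps, excluded by this choice. *)
pose eps := Num.min 2^-1 (r `^ gamma * r).
have eps_gt0 : 0 < eps by rewrite lt_min invr_gt0 mulr_gt0 ?powR_gt0 //=; lra.
have eps_lt1 : eps < 1 by rewrite gt_min; apply/orP; left; lra.
have eps_bd : 0 < eps < 1 by rewrite eps_gt0.
have [S [m [/andP[S_gt0 S_le1] Sgamma m_gt0 le_bF eq_bF]]] :=
  barrier_contact n_gt0 _ _ _ _ _ _ phi_solution gamma_gt0 eps_bd.
have S01 : 0 <= S <= 1 by rewrite ltW.
pose C := Num.sqrt (1 - S ^+ 2).
have CS : C ^+ 2 + S ^+ 2 = 1.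
  by rewrite sqr_sqrtr ?subrK // subr_ge0 expr_le1 // ltW.
pose F := homogeneous_profile (n := n) alpha phi.
have twF : twice_differentiable F (meridian S).
  by apply: (solution_twice_differentiable phi_solution);
    rewrite /half_space /= last_coord_meridian.
have pF : pucci_inf lambda Lambda (hessian F (meridian S)) = 0.
  by apply: (solution_pucci phi_solution);
    rewrite /half_space /= last_coord_meridian.
have [I [a [y [a_bd y_on]]]] :=
  pucci_inf_realization _ _ _ _ _ lambda_le_Lambda (hessian_sym _ _ twF).
pose h k := \sum_i \sum_j y k 0 i * y k 0 j * hessian F (meridian S) i j.
rewrite pF -[X in X = _]/(\sum_k a k * h k) => sum0.
pose y0 k := y k 0 ord0; pose y1 k := y k 0 ord_max.
(* Coordinates of [y k] along the contact point and along its quarter turn in the plane of the first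
   and last axes. *)
pose xi k := C * y0 k + S * y1 k.
pose zeta k := C * y1 k - S * y0 k.
pose e k := \sum_i y k 0 i ^+ 2.
have o01 : (ord_max != ord0 :> 'I_n.+1) by rewrite -val_eqE /= -lt0n.
have s00 : \sum_k y0 k * y0 k = 1 by rewrite y_on eqxx.
have s11 : \sum_k y1 k * y1 k = 1 by rewrite y_on eqxx.
have s01 : \sum_k y0 k * y1 k = 0 by rewrite y_on eq_sym (negbTE o01).
have sumE (u v w : R) :
    \sum_k (u * (y0 k * y0 k) + v * (y0 k * y1 k) + w * (y1 k * y1 k))
    = u + w.
  by rewrite !big_split /= -!mulr_sumr s00 s01 s11 mulr0 addr0 !mulr1.
have X1 : \sum_k xi k ^+ 2 = 1.
  rewrite -CS -(sumE (C ^+ 2) (2 * C * S) (S ^+ 2)).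
  by apply: eq_bigr => k _; rewrite /xi; ring.
have Z1 : \sum_k zeta k ^+ 2 = 1.
  rewrite -CS addrC -(sumE (S ^+ 2) (- 2 * C * S) (C ^+ 2)).
  by apply: eq_bigr => k _; rewrite /zeta; ring.
have XZ0 : \sum_k xi k * zeta k = 0.
  rewrite -[RHS](addNr (C * S)) -(sumE (- (C * S)) (C ^+ 2 - S ^+ 2) (C * S)).
  by apply: eq_bigr => k _; rewrite /xi /zeta; ring.
have eN : \sum_k e k = N.
  rewrite /e exchange_big (eq_bigr (fun=> 1)) ?sumr_const ?card_ord //= => i _.
  by rewrite (eq_bigr (fun k => y k 0 i * y k 0 i)) // y_on eqxx.
have xze k : xi k ^+ 2 + zeta k ^+ 2 <= e k.
  have -> : xi k ^+ 2 + zeta k ^+ 2 = (C ^+ 2 + S ^+ 2) * (y0 k ^+ 2 + y1 k ^+ 2).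
    by rewrite /xi /zeta; ring.
  rewrite CS mul1r /e (bigD1 ord0) //= (bigD1 ord_max) //= addrA lerDl.
  by apply: sumr_ge0 => i _; exact: sqr_ge0.
have a_bd' k : lambda <= a k <= K * lambda by rewrite -LE.
have B := barrier_form_sum _ a xi zeta e lambda K N p C S N2 K1 (ltW p_gt1)
  lambda_gt0 S_gt0 CS a_bd' xze X1 Z1 XZ0 eN.
rewrite /= -/eta -/gamma in B.
have sE : p * (K * (N + 1) - 1) = gamma + alpha.
  by rewrite alphaE /gamma /beta; ring.
have yE k : (S * xi k + C * zeta k) / S = y1 k / S.
  congr (_ / _); rewrite -[RHS]mul1r -CS /xi /zeta; ring.
pose q1 k := gamma * (gamma - 1) * (y1 k / S) ^+ 2
    + (gamma + alpha) * (gamma + alpha + 2) * xi k ^+ 2 - (gamma + alpha) * e k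
    - 2 * gamma * (gamma + alpha) * xi k * (y1 k / S).
pose q2 k := alpha * (alpha + 2) * xi k ^+ 2 - alpha * e k.
have {}B : eta / S ^+ 2 <= \sum_k a k * q1 k.
  apply: le_trans B _; rewrite le_eqVlt; apply/orP; left; apply/eqP.
  by apply: eq_bigr => k _; rewrite sE yE.
have contact k : S `^ gamma * q1 k - eps * q2 k <= m * h k.
  have := contact_second_order F alpha gamma eps m (xi k) (y1 k / S) (e k)
    (meridian S) (y k) twF.
  rewrite (last_coord_meridian n_gt0); move=> ch; apply: ch => //.
    exact: sum_sq_meridian.
  by rewrite sum_meridian.
have a_gt0 k : 0 < a k by case/andP: (a_bd k) => la _; exact: lt_le_trans la.
have Q2 : \sum_k a k * q2 k <= M.
  rewrite -[M]mulr1 -X1 mulr_sumr; apply: ler_sum => k _.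
  have e_ge0 : 0 <= e k by apply: sumr_ge0 => i _; exact: sqr_ge0.
  apply: (@le_trans _ _ (a k * (alpha * (alpha + 2) * xi k ^+ 2))).
    by rewrite ler_pM2l // /q2 gerBl mulr_ge0 // ltW.
  have -> : M * xi k ^+ 2 = Lambda * (alpha * (alpha + 2) * xi k ^+ 2).
    by rewrite /M; ring.
  rewrite ler_wpM2r //; last by case/andP: (a_bd k).
  by apply: mulr_ge0; [rewrite mulr_ge0 ?addr_ge0 ?(ltW alpha_gt0)|exact: sqr_ge0].
have total : S `^ gamma * (\sum_k a k * q1 k) - eps * (\sum_k a k * q2 k)
    <= m * \sum_k a k * h k.
  rewrite !mulr_sumr -sumrB; apply: ler_sum => k _.
  rewrite mulrCA (mulrCA eps) (mulrCA m) -mulrBr ler_pM2l //; exact: contact.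
rewrite sum0 mulr0 subr_le0 in total.
have Sg_gt0 : 0 < S `^ gamma by exact: powR_gt0.
have S2_gt0 : 0 < S ^+ 2 by exact: exprn_gt0.
(* Chain [B], [total] and [Q2], then divide by [M]. *)
have key : S `^ gamma * r <= eps * S ^+ 2.
  rewrite mulrA ler_pdivrMr // mulrAC -ler_pdivrMr // -mulrA.
  apply: le_trans (le_trans _ total) _; first by rewrite ler_pM2l.
  by rewrite ler_pM2l.
have S2_le : S ^+ 2 <= S by rewrite expr2 ler_piMr // ltW.
have r_lt : r < S.
  apply: lt_le_trans S2_le; rewrite -(ltr_pM2l Sg_gt0).
  by apply: le_lt_trans key _; rewrite ltr_pM2r.
have : S `^ gamma * r <= r `^ gamma * r.
  apply: (le_trans key); apply: (@le_trans _ _ eps).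
    by rewrite ler_piMr ?(ltW eps_gt0) // (le_trans S2_le).
  by rewrite ge_min lexx orbT.
by rewrite ler_pM2r // leNgt gt0_ltr_powR // nnegrE ltW.
Qed.
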